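(* Let $p$ be a prime, let $r,m$ be positive integers with $r\ge3$ and $r\mid m$, and put $q=p^m$, $n=p^r$. Let $k\ge3$, $t\ge1$, $h\ge0$ be integers with $k<n$ and $t+h\le k-1$, let $\eta\in\mathbb{F}_{p^m}^{*}$, write $\mathbb{F}_{p^r}=\{\alpha_{i_1},\ldots,\alpha_{i_n}\}\subseteq\mathbb{F}_{p^m}$ and $\boldsymbol{\alpha}=(\alpha_{i_1},\ldots,\alpha_{i_n})$. Then $\mathcal{C}_{\mathcal{V}_{k,t,h,\eta}}(\boldsymbol{\alpha},\boldsymbol{1})$ is self-orthogonal if one of the following conditions holds: (1) $t=1$ and $2k+t+2=p^r$; (2) $t$ is odd with $t\ge3$, and $2k+t=p^r$; (3) $t=2$ and $2k+t+3=p^r$; (4) $t$ is even with $t\ge4$, and $2k+t+1=p^r$.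
   Context: $\boldsymbol{1}=(1,\ldots,1)$. For $h\le k-1$ and $\eta\in\mathbb{F}_q^*=\mathbb{F}_q\setminus\{0\}$, $$\mathcal{V}_{k,t,h,\eta}=\Big\{\sum_{i=0}^{k-1}a_ix^i+\eta a_hx^{k-1+t}\ \Big|\ a_0,\ldots,a_{k-1}\in\mathbb{F}_q\Big\},$$ and for $\boldsymbol{\alpha}=(\alpha_{i_1},\ldots,\alpha_{i_n})$ with pairwise distinct entries in $\mathbb{F}_q$ and $\boldsymbol{v}\in(\mathbb{F}_q^* )^n$, $$\mathcal{C}_{\mathcal{V}_{k,t,h,\eta}}(\boldsymbol{\alpha},\boldsymbol{v})=\{(v_1f(\alpha_{i_1}),\ldots,v_nf(\alpha_{i_n}))\mid f\in\mathcal{V}_{k,t,h,\eta}\}.$$ A linear code $\mathcal{C}\subseteq\mathbb{F}_q^n$ is self-orthogonal if $\mathcal{C}\subseteq\mathcal{C}^\perp$ with respect to the Euclidean inner product. *)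

(* Defs.v *)
From HB Require Import structures.
From mathcomp Require Import all_boot all_order all_algebra.
From mathcomp Require Import classical_sets.
Set Implicit Arguments.
Unset Strict Implicit.
Unset Printing Implicit Defensive.
Import GRing.Theory.
Local Open Scope ring_scope.
Local Open Scope classical_set_scope.

Section TwistedCodes.
Variable F : finFieldType.

(* The coefficients (a_0, ..., a_{k-1}) are a k-tuple and a`_i is its i-th
   entry; a`_h is meaningful only for h < k (it is 0 otherwise). *)
Definition twisted_poly (k t h : nat) (eta : F) (a : k.-tuple F) : {poly F} :=
  \sum_(i < k) a`_i *: 'X^i + (eta * a`_h) *: 'X^(k - 1 + t).

Definition twisted_polys (k t h : nat) (eta : F) : set {poly F} :=
  [set twisted_poly t h eta a | a in [set: k.-tuple F]].

Definition eval_code (n : nat) (V : set {poly F}) (alpha v : 'rV[F]_n) :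
    set 'rV[F]_n :=
  [set \row_j (v 0 j * f.[alpha 0 j]) | f in V].

Definition twisted_code (n k t h : nat) (eta : F) (alpha v : 'rV[F]_n) :
    set 'rV[F]_n :=
  eval_code (twisted_polys k t h eta) alpha v.

Definition dotr (n : nat) (x y : 'rV[F]_n) : F := \sum_j x 0 j * y 0 j.

Definition dual_code (n : nat) (C : set 'rV[F]_n) : set 'rV[F]_n :=
  [set y | forall x, C x -> dotr x y = 0].

Definition linear_code (n : nat) (C : set 'rV[F]_n) : Prop :=
  C 0 /\ forall (b : F) (x y : 'rV[F]_n), C x -> C y -> C (b *: x + y).

Definition self_orthogonal (n : nat) (C : set 'rV[F]_n) : Prop :=
  C `<=` dual_code C.

Lemma twisted_code_linear (n k t h : nat) (eta : F) (alpha v : 'rV[F]_n) :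
  (h < k)%N -> linear_code (twisted_code k t h eta alpha v).
Proof.
move=> hk; split.
  exists 0; last by apply/rowP => j; rewrite !mxE horner0 mulr0.
  exists [tuple (0 : F) | i < k] => //.
  rewrite /twisted_poly -[h]/(nat_of_ord (Ordinal hk)) nth_mktuple mulr0 scale0r.
  by rewrite addr0 big1 // => i _; rewrite nth_mktuple scale0r.
move=> b _ _ [_ [a1 _ <-] <-] [_ [a2 _ <-] <-].
exists (b *: twisted_poly t h eta a1 + twisted_poly t h eta a2); last first.
  by apply/rowP => j; rewrite !mxE hornerD hornerZ mulrDr mulrCA.
exists [tuple b * a1`_i + a2`_i | i < k] => //.
rewrite /twisted_poly -[h]/(nat_of_ord (Ordinal hk)) nth_mktuple.
under eq_bigr do rewrite nth_mktuple scalerDl -scalerA.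
rewrite big_split /= -scaler_sumr mulrDr mulrCA scalerDl -scalerA scalerDr.
by rewrite -(scalerA b) addrACA.
Qed.

End TwistedCodes.

(* Main.v *)
(* Over a subfield with n elements the power sum of exponent e vanishes unless e
   is a positive multiple of n - 1. In a product of two twisted polynomials all
   monomials have degree at most 2k - 2 + t <= n - 2, except the product of the
   two twists, of degree 2(k - 1 + t); each of the four conditions makes this
   degree smaller than n - 1 or strictly between n - 1 and 2(n - 1). *)
Require Import Defs.
From HB Require Import structures.
From mathcomp Require Import all_boot all_order all_algebra.
From mathcomp Require Import zify ring.
Set Implicit Arguments.
Unset Strict Implicit.
Unset Printing Implicit Defensive.
Import GRing.Theory.
Local Open Scope ring_scope.

Section PowerSums.
Variables (F : finFieldType) (S : {set F}).
Hypothesis S_subfield : divring_closed S.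

Lemma subfield_mulr_imset (y : F) : y \in S -> y != 0 ->
  [set y * x | x in S] = S.
Proof.
case: S_subfield => S1 _ SV Sy y0; apply/setP => x; apply/imsetP/idP.
  case=> z Sz ->.
  (* [divring_closed] gives closure under quotients only, so y * z is read as y / (1 / z); since
     0^-1 = 0, this also covers z = 0. *)
  by rewrite -[z]invrK; apply: (SV) => //; rewrite -[z^-1]mul1r; apply: SV.
by move=> Sx; exists (x / y); [apply: SV | rewrite mulrC divfK].
Qed.

(** Multiplication by y permutes the nonzero elements of S, so their nonzero product is unchanged
    when multiplied by y ^+ #|S|.-1. *)
Lemma subfield_expr_card (y : F) : y \in S -> y != 0 -> y ^+ #|S|.-1 = 1.
Proof.
move=> Sy y0; case: (S_subfield) => S1 SB _.
have S0 : 0 \in S by rewrite -(subrr 1); apply: SB.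
have P0 : \prod_(x in S :\ 0) x != 0.
  by apply/prodf_neq0 => x; rewrite !inE => /andP[].
apply: (mulIf P0); rewrite mul1r (cardsD1 0 S) S0 add1n /=.
rewrite -prodr_const -big_split /=.
rewrite -(big_imset (fun x => x)) /=; last by move=> u v _ _; apply: mulfI.
apply: eq_bigl => x; rewrite -[in RHS](subfield_mulr_imset Sy y0) !inE.
apply/imsetP/andP => [[z /setD1P[z0 Sz] ->]|[x0 /imsetP[z Sz xE]]].
  by rewrite mulf_neq0 //; split=> //; apply/imsetP; exists z.
exists z => //; rewrite !inE Sz andbT.
by apply: contraNneq x0 => z0; rewrite xE z0 mulr0.
Qed.

(** The translation x - 1 permutes S, so the sum of all elements of S equals itself minus #|S|. *)
Lemma subfield_card_eq0 : #|S|%:R = 0 :> F.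
Proof.
case: S_subfield => S1 SB _.
have SE : [set x - 1 | x in S] = S.
  apply/eqP; rewrite eqEcard card_imset ?leqnn ?andbT; last exact: addIr.
  by apply/subsetP => _ /imsetP[x Sx ->]; apply: SB.
have := erefl (\sum_(x in S) x).
rewrite -{1}SE big_imset /=; last by move=> u v _ _; apply: addIr.
rewrite sumrB sumr_const => /eqP.
by rewrite -subr_eq0 addrAC subrr sub0r oppr_eq0 => /eqP.
Qed.

(** Otherwise all #|S| - 1 nonzero elements of S would be roots of X^d - 1, where d is the remainder
    of e modulo #|S| - 1. As 0 < d < #|S| - 1, that is too many roots for a nonzero polynomial. *)
Lemma exists_expr_neq1 (e : nat) : ~~ (#|S|.-1 %| e)%N ->
  exists y, [/\ y \in S, y != 0 & y ^+ e != 1].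
Proof.
move=> ndv; case: (S_subfield) => S1 SB _.
have S0 : 0 \in S by rewrite -(subrr 1); apply: SB.
have cS : #|S|.-1 = #|S :\ 0| by rewrite (cardsD1 0 S) S0.
have n0 : (0 < #|S|.-1)%N.
  by rewrite cS; apply/card_gt0P; exists 1; rewrite !inE oner_neq0.
have d0 : (0 < e %% #|S|.-1)%N by rewrite lt0n.
have [y /and3P[]|all1] := pickP [pred y | [&& y \in S, y != 0 & y ^+ e != 1]].
  by exists y.
have rts : all (root ('X^(e %% #|S|.-1) - 1%:P)) (enum (S :\ 0)).
  apply/allP => y; rewrite mem_enum !inE => /andP[y0 Sy].
  have := all1 y; rewrite /= Sy y0 => /negbFE/eqP yE.
  rewrite /root !hornerE subr_eq0 -yE {2}(divn_eq e #|S|.-1).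
  by rewrite exprD mulnC exprM subfield_expr_card // expr1n mul1r.
have := max_poly_roots _ rts (enum_uniq _).
rewrite -size_poly_eq0 size_XnsubC // => /(_ isT).
by rewrite -cardE -cS ltnS leqNgt ltn_mod n0.
Qed.

(* Summing over [y * x] instead of [x] multiplies the power sum by [y ^+ e]. *)
Lemma sum_expr_eq0 (e : nat) : e = 0%N \/ ~~ (#|S|.-1 %| e)%N ->
  \sum_(x in S) x ^+ e = 0.
Proof.
case=> [->|/exists_expr_neq1[y [Sy y0 ye]]].
  (* Here 0 ^+ 0 = 1, so x = 0 contributes too and the sum is exactly #|S|. *)
  by under eq_bigr do rewrite expr0; rewrite sumr_const subfield_card_eq0.
have : \sum_(x in S) x ^+ e = y ^+ e * \sum_(x in S) x ^+ e.
  rewrite -{1}(subfield_mulr_imset Sy y0) big_imset /=; last first.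
    by move=> u v _ _; apply: mulfI.
  by rewrite big_distrr /=; apply: eq_bigr => x _; rewrite exprMn.
move/eqP; rewrite -subr_eq0 -{1}[\sum_(_ in S) _]mul1r -mulrBl mulf_eq0.
by rewrite subr_eq0 eq_sym (negPf ye) => /eqP.
Qed.

(** Size is degree plus one, so every exponent in P is at most #|S| - 2: it is 0 or too small to be
    a multiple of #|S| - 1. *)
Lemma sum_horner_eq0 (P : {poly F}) : (size P < #|S|)%N ->
  \sum_(x in S) P.[x] = 0.
Proof.
move=> szP; under eq_bigr do rewrite horner_coef.
rewrite exchange_big big1 //= => i _; rewrite -big_distrr /= sum_expr_eq0 ?mulr0 //.
have iS : (i < #|S|.-1)%N by rewrite -ltnS prednK ?(leq_trans _ szP) // ltnS.
case: (posnP i) => i0; [by left | right].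
by apply: contraTN iS => /(dvdn_leq i0); rewrite leqNgt.
Qed.

Lemma sum_horner_mul_twisted_eq0 (f g : {poly F}) (b c : F) (k l : nat) :
  (size f <= k)%N -> (size g <= k)%N -> (k <= l.+1)%N -> (k + l < #|S|)%N ->
  ~~ (#|S|.-1 %| l.*2)%N ->
  \sum_(x in S) (f + b *: 'X^l).[x] * (g + c *: 'X^l).[x] = 0.
Proof.
move=> szf szg kl klS ndv.
have szX (d : F) : (size (d *: 'X^l) <= l.+1)%N.
  by rewrite (leq_trans (size_scale_leq _ _)) ?size_polyXn.
have szM (u v : {poly F}) :
    (size u <= k)%N -> (size v <= l.+1)%N -> (size (u * v)%R <= k + l)%N.
  by move=> su sv; apply: leq_trans (size_polyMleq _ _) _; lia.
have szg' : (size (g + c *: 'X^l)%R <= l.+1)%N.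
  by rewrite (leq_trans (size_polyD _ _)) // geq_max (leq_trans szg) ?szX.
(* P is the product without the term b c X^(2l). Each of its two summands has a factor of size at
   most k and one of size at most l + 1. *)
pose P := f * (g + c *: 'X^l) + g * (b *: 'X^l).
transitivity (\sum_(x in S) (P.[x] + b * c * x ^+ l.*2)).
  apply: eq_bigr => x _; rewrite /P !hornerE -addnn exprD /=; ring.
rewrite big_split /= -big_distrr /= (sum_expr_eq0 (or_intror ndv)).
rewrite mulr0 addr0 sum_horner_eq0 //.
by apply: leq_ltn_trans klS; rewrite (leq_trans (size_polyD _ _)) // geq_max !szM.
Qed.

End PowerSums.

Theorem theorem4p4 (p r m n k t h : nat) (F : finFieldType) (S : {set F})
    (eta : F) (alpha : 'rV[F]_n)
    (p_prime : prime p) (m_gt0 : (0 < m)%N) (r_ge3 : (3 <= r)%N)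
    (r_dvd_m : (r %| m)%N)
    (cardF : #|F| = (p ^ m)%N) (n_def : n = (p ^ r)%N)
    (k_ge3 : (3 <= k)%N) (t_ge1 : (1 <= t)%N)
    (k_lt_n : (k < n)%N) (th_le : (t + h <= k - 1)%N)
    (eta_neq0 : eta != 0)
    (S_subfield : divring_closed S) (cardS : #|S| = (p ^ r)%N)
    (alpha_inj : injective (alpha 0))
    (alpha_enum : S = [set alpha 0 j | j : 'I_n])
    (cases : [\/ (t = 1 /\ 2 * k + t + 2 = p ^ r)%N,
                 [/\ odd t, (3 <= t)%N & (2 * k + t = p ^ r)%N],
                 (t = 2 /\ 2 * k + t + 3 = p ^ r)%N
               | [/\ ~~ odd t, (4 <= t)%N & (2 * k + t + 1 = p ^ r)%N]]) :
  self_orthogonal (twisted_code k t h eta alpha (const_mx 1)).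
Proof.
move=> _ [_ [a _ <-] <-] _ [_ [b _ <-] <-]; rewrite /dotr.
set f := twisted_poly t h eta a; set g := twisted_poly t h eta b.
(* With multipliers 1 and [alpha] listing S without repetition, the inner product is a sum over
   S. *)
transitivity (\sum_(x in S) g.[x] * f.[x]).
  rewrite alpha_enum big_imset /=; last by move=> i j _ _; apply: alpha_inj.
  by apply: eq_big => [j|j _]; rewrite ?inE // !mxE !mul1r.
have sz (c : k.-tuple F) : (size (\sum_(i < k) c`_i *: 'X^i)%R <= k)%N.
  apply: (leq_trans (size_sum _ _ _)); apply/bigmax_leqP => i _.
  by rewrite (leq_trans (size_scale_leq _ _)) ?size_polyXn.
apply: sum_horner_mul_twisted_eq0 (sz b) (sz a) _ _ _ => //; first by lia.
  (* The bound is 2k - 1 + t < p^r, which is tight when 2k + t = p^r. *)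
  by rewrite cardS; case: cases => [[]|[]|[]|[]]; lia.
rewrite cardS; set N := (p ^ r)%N in cases *.
(* The doubled exponent is N - 3 for t = 1 and t = 2, N + t - 2 for odd t >= 3, and N + t - 3 for
   even t >= 4. The last two exceed N - 1, and stay below 2(N - 1) because t < N. *)
have [lt|[gt lt]] : (0 < (k - 1 + t).*2 < N.-1)%N \/
    (N.-1 < (k - 1 + t).*2 /\ (k - 1 + t).*2 < N.-1.*2)%N.
- by case: cases => [[]|[]|[]|[]]; lia.
- case/andP: lt => gt0 lt; by rewrite gtnNdvd.
have -> : (k - 1 + t).*2 = (N.-1 + ((k - 1 + t).*2 - N.-1))%N by lia.
by rewrite dvdn_addr ?dvdnn // gtnNdvd //; lia.
Qed.
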